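(* Let $1\le p<\infty$. Suppose that the metric space $(X,d)$ has the Heine-Borel property and that $\mu\in\mathcal{P}_{p}(X)$. Let $(\Omega,\mathcal{F},\mathbb{P})$ be a complete probability space on which i.i.d. $X$-valued random elements $Y_1,Y_2,\ldots$ with common distribution $\mu$ are defined, and let $\bar\mu_n=\frac1n\sum_{i=1}^n\delta_{Y_i}$. Then for any random elements $\{(C_n,\eta_n)\}_{n\in\mathbb{N}}$ and $(C,\eta)$ in $\mathrm{C}(X)\times[0,\infty)$, we have $$\lim_{n\to\infty}\rho\big(F_p(\bar\mu_n,C_n,\eta_n),F_p(\mu,C,\eta)\big)=0$$ almost surely on $\{\mathrm{Lt}_{n\to\infty}C_n=C \text{ and } \eta_n\to\eta\}$.
   Context: A metric space has the Heine-Borel property if its closed bounded subsets are compact. Convention: $0^0=1$. For $r\ge 0$, $\mathcal{P}_r(X)$ is the set of Borel probability measures $\mu$ on $X$ with $\int_X d^r(x,y)\,d\mu(y)<\infty$ for all $x\in X$. For $\mu\in\mathcal{P}_{p-1}(X)$ and $x,z\in X$ set $f_p(\mu,x,z)=\int_X (d^p(x,y)-d^p(z,y))\,d\mu(y)$ (the integrand is $\mu$-integrable). For $C\subseteq X$ closed and $\eta\ge0$, $$F_p(\mu,C,\eta)=\{x\in C: f_p(\mu,x,z)\le\eta\ \text{for all } z\in C\}.$$ For non-empty compact $A,A'\subseteq X$, $\rho(A,A')=\max_{x\in A}\min_{x'\in A'}d(x,x')$ (one-sided Hausdorff distance). $\mathrm{C}(X)$ is the collection of all closed subsets of $X$, equipped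 with the Effros $\sigma$-algebra, generated by the sets $\{C\in \mathrm{C}(X): C\cap U\neq\emptyset\}$, $U\subseteq X$ open. For a sequence $\{C_n\}$ in $\mathrm{C}(X)$, $\mathrm{Ls}_{n\to\infty}C_n$ is the set of $x\in X$ such that every open neighborhood of $x$ meets $C_n$ for infinitely many $n$, and $\mathrm{Li}_{n\to\infty}C_n$ is the set of $x\in X$ such that every open neighborhood of $x$ meets $C_n$ for all sufficiently large $n$. We write $\mathrm{Lt}_{n\to\infty}C_n=C$ if $\mathrm{Ls}_{n\to\infty}C_n=\mathrm{Li}_{n\to\infty}C_n=C$. ''Almost surely on $E$'' means that there is a $\mathbb{P}$-null set $N$ such that the conclusion holds for all $\omega\in E\setminus N$.
   Formalization: The limit is claimed almost surely on the part of the event where C is non-empty: C(X) contains the empty set, and if C is empty then F_p(μ,C,η) is empty and ρ, defined only for non-empty compact sets, is undefined. *)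

(* Defs.v *)
From HB Require Import structures.
From mathcomp Require Import all_boot all_order all_algebra finmap.
From mathcomp Require Import all_classical all_reals all_analysis.

Set Implicit Arguments.
Unset Strict Implicit.
Unset Printing Implicit Defensive.

Import Order.TTheory GRing.Theory Num.Theory.
Import numFieldNormedType.Exports.

Local Open Scope classical_set_scope.
Local Open Scope ring_scope.

(* Measurable types are pointed in the library, hence the need for pointed
   metric spaces. This only excludes the empty space, which carries no
   probability measure. *)
#[short(type="pmetricType")]
HB.structure Definition PointedMetric (K : numDomainType) :=
  { M of Metric K M & isPointed M }.

Notation borel X := (g_sigma_algebraType (@open X)).

Definition metric_bounded (R : realType) (X : metricType R) (A : set X) : Prop :=
  exists M : R, forall x y, A x -> A y -> mdist x y <= M.

Definition heine_borel (R : realType) (X : metricType R) : Prop :=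
  forall A : set X, closed A -> metric_bounded A -> compact A.

Record closedSet (X : topologicalType) := ClosedSet {
  closedSet_set :> set X;
  closedSet_closed : closed closedSet_set }.

HB.instance Definition _ (X : topologicalType) := gen_eqMixin (closedSet X).
HB.instance Definition _ (X : topologicalType) := gen_choiceMixin (closedSet X).
HB.instance Definition _ (X : topologicalType) :=
  isPointed.Build (closedSet X) (ClosedSet (@closed0 X)).

Definition effros_generator (X : topologicalType) : set (set (closedSet X)) :=
  [set [set C : closedSet X | C `&` U !=set0] | U in @open X].

Notation effros X := (g_sigma_algebraType (@effros_generator X)).

Section kuratowski_limits.
Context {X : topologicalType}.

Definition Ls (C_ : nat -> set X) : set X :=
  [set x | forall U, open_nbhs x U -> infinite_set [set n | C_ n `&` U !=set0]].

Definition Li (C_ : nat -> set X) : set X :=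
  [set x | forall U, open_nbhs x U -> \forall n \near \oo, C_ n `&` U !=set0].

Definition Lt (C_ : nat -> set X) (C : set X) : Prop := Ls C_ = C /\ Li C_ = C.

End kuratowski_limits.

(* Max-min on non-empty compact sets. In general [rho set0 A' = -oo], and
   [rho A set0 = +oo] when [A] is not empty, so that convergence of [rho] to 0
   forces the second argument, and eventually the first, to be non-empty. *)
Definition rho (R : realType) (X : metricType R) (A A' : set X) : \bar R :=
  ereal_sup [set ereal_inf [set (mdist x x')%:E | x' in A'] | x in A].

Section frechet.
Context {R : realType} {X : pmetricType R}.

(* [powR] satisfies 0 `^ 0 = 1. *)
Definition finite_moment (r : R) (mu : {measure set borel X -> \bar R}) : Prop :=
  forall x : X, (\int[mu]_(y in [set: borel X]) (mdist x y `^ r)%:E < +oo)%E.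

Definition frechet_diff (p : R) (mu : {measure set borel X -> \bar R})
    (x z : X) : \bar R :=
  (\int[mu]_(y in [set: borel X]) (mdist x y `^ p - mdist z y `^ p)%:E)%E.

Definition frechet_set (p : R) (mu : {measure set borel X -> \bar R})
    (C : set X) (eta : R) : set X :=
  [set x | C x /\ forall z, C z -> (frechet_diff p mu x z <= eta%:E)%E].

(* Uses the first [n] points [y 0, ..., y (n - 1)]; it is the zero measure when
   [n = 0]. *)
Definition empirical_measure (y : nat -> borel X) (n : nat) :
    {measure set borel X -> \bar R} :=
  mscale ((n%:R : R)^-1)%:nng (msum (fun i => \d_(y i)) n).

End frechet.

Definition mutually_independent d (Omega : measurableType d) d'
    (T : measurableType d') (R : realType) (P : probability Omega R)
    (Y : nat -> {RV P >-> T}) : Prop :=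
  forall (J : {fset nat}) (B : nat -> set T),
    (forall j, j \in J -> measurable (B j)) ->
    P (\bigcap_(j in [set` J]) (Y j @^-1` B j)) =
      (\prod_(j <- J) P (Y j @^-1` B j))%E.

(* Measures carry no information on non-measurable sets, whence the
   restriction. *)
Definition has_distribution d (Omega : measurableType d) d'
    (T : measurableType d') (R : realType) (P : probability Omega R)
    (Y : {RV P >-> T}) (mu : {measure set T -> \bar R}) : Prop :=
  forall A, measurable A -> distribution P Y A = mu A.

(* Main.v *)
(* Write H(x) for the integral of d(x,y)^p dmu(y) and H_n for its empirical
   counterpart. Since mu has a finite p-th moment, F_p(mu,C,eta) is the set of
   eta-minimizers of H on C. By Minkowski's inequality the p-th roots of H and
   of all the H_n are 1-Lipschitz, so the strong law of large numbers on a
   countable dense set gives, almost surely, H_n(x_n) -> H(x) whenever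
   x_n -> x. The same inequality makes the H_n coercive uniformly in n, so that
   the sets of eta_n-minimizers eventually lie in one compact ball, where a
   limit point of eta_n-minimizers is an eta-minimizer.

   The strong law is proved for nonnegative summands along r 2^n for each
   fixed r, where the variance estimate and the Borel-Cantelli lemma reduce to
   geometric sums; monotonicity of the partial sums then fills the gaps, as the
   sequences for M <= r <= 2M together have ratio at most 1 + 1/M. *)

Require Import Defs.
From HB Require Import structures.
From mathcomp Require Import all_boot all_order all_algebra finmap.
From mathcomp Require Import all_classical all_reals all_analysis.
From mathcomp Require Import measurable_realfun.
From mathcomp Require Import ring lra.

Import Order.TTheory GRing.Theory Num.Theory.
Import numFieldNormedType.Exports.

Local Open Scope classical_set_scope.
Local Open Scope ring_scope.

Set Implicit Arguments.
Unset Strict Implicit.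

(** * Strong law of large numbers *)

Section iid_variance.
Context d (Omega : measurableType d) d' (T : measurableType d') (R : realType).
Context (P : probability Omega R) (mu : probability T R).
Context (Y : nat -> {RV P >-> T}).
Hypothesis Yindep : mutually_independent Y.
Hypothesis Ydistr : forall i, has_distribution (Y i) mu.
Local Open Scope ereal_scope.

Lemma ge0_integral_rv (i : nat) (f : T -> \bar R) :
  measurable_fun [set: T] f -> (forall y, 0 <= f y) ->
  \int[P]_w f (Y i w) = \int[mu]_y f y.
Proof.
move=> mf f0; rewrite -(@ge0_integral_distribution _ _ _ _ _ P (Y i) f mf f0).
by apply: eq_measure_integral => A mA _; exact: Ydistr.
Qed.

Lemma probability_rv (i : nat) (A : set T) : measurable A -> P (Y i @^-1` A) = mu A.
Proof. by move=> mA; rewrite -(Ydistr i mA). Qed.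

Lemma indep_pair (i j : nat) (A B : set T) : i != j ->
  measurable A -> measurable B ->
  P (Y i @^-1` A `&` Y j @^-1` B) = mu A * mu B.
Proof.
move=> ij mA mB.
have := @Yindep [fset i; j]%fset (fun k => if k == i then A else B).
rewrite big_fsetU1 ?inE// big_seq_fset1 eqxx eq_sym (negbTE ij).
rewrite !probability_rv// => <-; last by move=> k _; case: ifP.
congr (P _); apply/seteqP; split => w /=.
  move=> [Aw Bw] k /=; rewrite !inE => /orP[]/eqP ->; rewrite ?eqxx//.
  by rewrite eq_sym (negbTE ij).
move=> H; split; first by have := H i; rewrite /= !inE eqxx; exact.
by have := H j; rewrite /= !inE eqxx orbT eq_sym (negbTE ij); exact.
Qed.

(** By independence the joint law of [(Y i, Y j)] agrees with [mu \x mu] on rectangles, hence on all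
    measurable sets; Tonelli then factors the integral. *)
Lemma ge0_integral_indep_pair (i j : nat) (g h : T -> R) : i != j ->
  measurable_fun [set: T] g -> measurable_fun [set: T] h ->
  (forall y, 0 <= g y)%R -> (forall y, 0 <= h y)%R ->
  \int[P]_w (g (Y i w) * h (Y j w))%:E =
  (\int[mu]_y (g y)%:E) * (\int[mu]_y (h y)%:E).
Proof.
move=> ij mg mh g0 h0.
pose YY w := (Y i w, Y j w).
have mYY : measurable_fun [set: Omega] YY by exact: measurable_fun_pair.
pose F (z : T * T) := (g z.1 * h z.2)%:E.
have mF : measurable_fun [set: T * T] F.
  apply/measurable_EFinP; apply: measurable_funM.
    exact: (measurableT_comp mg measurable_fst).
  exact: (measurableT_comp mh measurable_snd).
have F0 z : 0 <= F z by rewrite lee_fin mulr_ge0.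
transitivity (\int[pushforward P YY]_z F z).
  by rewrite ge0_integral_pushforward.
transitivity (\int[(mu \x mu)]_z F z).
  apply: eq_measure_integral => A mA _; apply/esym.
  have mYY' := isMeasurableFun.Build _ _ _ _ _ mYY.
  pose YYm : {mfun Omega >-> (T * T)%type} := HB.pack YY mYY'.
  apply: (@product_measure_unique _ _ _ _ _ mu mu (distribution P YYm)) => //.
  by move=> B C mB mC; rewrite -(indep_pair ij mB mC).
rewrite fubini_tonelli1// /fubini_F /F /=.
under eq_integral do under eq_integral do rewrite EFinM.
under eq_integral => x _.
  rewrite ge0_integralZl//; last first.
  - by rewrite lee_fin.
  - by move=> y _; rewrite lee_fin.
  - exact/measurable_EFinP.
  over.
rewrite ge0_integralZr//.
- exact/measurable_EFinP.
- by move=> y _; rewrite lee_fin.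
- by apply: integral_ge0 => y _; rewrite lee_fin.
Qed.

Lemma bounded_Lfun2 (f : Omega -> R) (M : R) :
  measurable_fun [set: Omega] f -> (forall w, `|f w| <= M)%R ->
  f \in Lfun P 2%:E.
Proof.
move=> mf fM; rewrite inE; apply/andP; split; rewrite inE//=.
rewrite /finite_norm unlock poweR_lty//=.
apply: (@le_lt_trans _ _ (\int[P]_w (M `^ 2)%:E)).
  apply: ge0_le_integral => //.
  - apply/measurable_EFinP.
    apply: (@measurableT_comp _ _ _ _ _ _ (@powR R ^~ 2%R)) => //.
    exact: measurableT_comp.
  - move=> w _; rewrite lee_fin ge0_ler_powR// nnegrE//.
    exact: (le_trans _ (fM w)).
by rewrite integral_cst// [X in _ * X](@probability_setT _ _ _ P) mule1 ltry.
Qed.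

Lemma covariance_indep (g : T -> R) (M : R) (i j : nat) : i != j ->
  measurable_fun [set: T] g -> (forall y, 0 <= g y <= M)%R ->
  covariance P (g \o Y i) (g \o Y j) = 0.
Proof.
move=> ij mg gM.
have g0 y : (0 <= g y)%R by case/andP: (gM y).
have mgY k : measurable_fun [set: Omega] (g \o Y k) by exact: measurableT_comp.
have gY2 k : g \o Y k \in Lfun P 2%:E.
  apply: (bounded_Lfun2 (M := M)) => // w.
  by rewrite ger0_norm ?g0//=; case/andP: (gM (Y k w)).
have Pfin : P setT \is a fin_num := fin_num_measure P _ measurableT.
have gY1 k := Lfun_subset12 Pfin (gY2 k).
rewrite covarianceE//; last exact: Lfun2_mul_Lfun1.
rewrite unlock.
have -> : \int[P]_w (((g \o Y i) * (g \o Y j))%R w)%:E =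
    \int[P]_w (g (Y i w) * g (Y j w))%:E by [].
rewrite ge0_integral_indep_pair//.
have E k : \int[P]_w ((g \o Y k) w)%:E = \int[mu]_y (g y)%:E.
  by rewrite -(@ge0_integral_rv k (EFin \o g))//; exact/measurable_EFinP.
have gfin : \int[mu]_y (g y)%:E \is a fin_num.
  by rewrite -(E i); have := expectation_fin_num (gY1 i); rewrite unlock.
by rewrite !E subee// fin_numM.
Qed.

(** Each partial sum is uncorrelated with the next term, so variances add; each variance is at most
    the second moment. The bound [M] serves only to secure square integrability and does not enter
    the estimate. *)
Lemma variance_iid_sum_le (g : T -> R) (M : R) (k : nat) :
  measurable_fun [set: T] g -> (forall y, 0 <= g y <= M)%R ->
  'V_P[(fun w => \sum_(i < k) g (Y i w))%R] <=
    k%:R%:E * \int[mu]_y (g y ^+ 2)%:E.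
Proof.
move=> mg gM.
have g0 y : (0 <= g y)%R by case/andP: (gM y).
have mgY i : measurable_fun [set: Omega] (g \o Y i) by exact: measurableT_comp.
have gY2 i : g \o Y i \in Lfun P 2%:E.
  apply: (bounded_Lfun2 (M := M)) => // w.
  by rewrite ger0_norm ?g0//=; case/andP: (gM (Y i w)).
pose S n := (\sum_(i < n) (g \o Y i))%R.
have SE n : S n = (fun w => \sum_(i < n) g (Y i w))%R.
  by apply/funext => w; rewrite /S fct_sumE.
have S2 n : S n \in Lfun P 2%:E by rewrite /S rpred_sum// lee1n.
have covS n m : (n <= m)%N -> covariance P (S n) (g \o Y m) = 0.
  elim: n => [_|n ih nm]; first by rewrite /S big_ord0 covariance_cst_l.
  rewrite /S big_ord_recr/= covarianceDl//; last exact: S2.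
  rewrite [X in X + _]ih ?(ltnW nm)// (covariance_indep (M := M))// ?add0e//.
  by rewrite ltn_eqF.
rewrite -SE; elim: k => [|k ih]; first by rewrite /S big_ord0 variance_cst mul0e.
rewrite /S big_ord_recr/= varianceD//; last exact: S2.
rewrite covS// mule0 adde0.
have -> : (k.+1%:R%:E : \bar R) = k%:R%:E + 1 by rewrite -natr1 EFinD.
rewrite ge0_muleDl ?lee_fin// mul1e.
apply: leeD => //.
rewrite varianceE// unlock.
have -> : \int[P]_w (((g \o Y k) ^+ 2)%R w)%:E = \int[mu]_y (g y ^+ 2)%:E.
  rewrite -(@ge0_integral_rv k (fun y => (g y ^+ 2)%:E))//.
  - exact/measurable_EFinP/measurable_funX.
  - by move=> y; rewrite lee_fin sqr_ge0.
by rewrite -[leRHS]adde0 leeD2l// oppe_le0 sqre_ge0.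
Qed.

End iid_variance.

(** * Geometric sums along [r * 2 ^ n] *)

Section dyadic_sums.
Context {R : realFieldType}.

(** The terms double, so those preceding a given one add up to at most that one; the largest term
    below [t] therefore accounts for half of the bound. With [t = f y] this yields the
    Borel-Cantelli sum. *)
Lemma sum_dyadic_lt (r : nat) (t : R) (N : nat) : 0 <= t ->
  \sum_(n < N) (if (r * 2 ^ n)%:R < t then (r * 2 ^ n)%:R else 0) <= 2 * t.
Proof.
move=> t0.
have geom M : \sum_(n < M) (if (r * 2 ^ n)%:R < t then (r * 2 ^ n)%:R else 0)
    <= (r * 2 ^ M)%:R :> R.
  elim: M => [|M ih]; first by rewrite big_ord0.
  rewrite big_ord_recr/= expnS mulnCA mul2n -addnn natrD lerD//.
  by case: ifP.
elim: N => [|N ih]; first by rewrite big_ord0 mulr_ge0.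
rewrite big_ord_recr/=; case: ifPn => [lt_t|_]; last by rewrite addr0.
have := geom N; lra.
Qed.

(** The reciprocals halve, so their sum is at most twice the first one counted, which is at most
    [t^-1]. Indices before it are discarded by replacing [r] with [r * 2]. With [t = f y] this
    yields the variance sum. *)
Lemma sum_dyadic_inv_ge (r : nat) (t : R) (N : nat) : (0 < r)%N -> 0 <= t ->
  t * \sum_(n < N) (if t <= (r * 2 ^ n)%:R then (r * 2 ^ n)%:R^-1 else 0) <= 2.
Proof.
move=> r0 t0.
have geom q M : (0 < q)%N -> \sum_(n < M)
    (if t <= (q * 2 ^ n)%:R then (q * 2 ^ n)%:R^-1 else 0) <= 2 / q%:R :> R.
  elim: M q => [|M ih] q q0; first by rewrite big_ord0 divr_ge0.
  rewrite big_ord_recl/= expn0 muln1.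
  under eq_bigr do rewrite /bump/= add1n expnS mulnA.
  have := ih (q * 2)%N; rewrite muln_gt0 q0/= => /(_ isT).
  rewrite natrM invfM mulrCA divff// mulr1 => h.
  have q0' : 0 < q%:R^-1 :> R by rewrite invr_gt0 ltr0n.
  by case: ifP => _; lra.
elim: N r r0 => [|N ih] r r0; first by rewrite big_ord0 mulr0.
have r0' : 0 < r%:R :> R by rewrite ltr0n.
have [tr|rt] := leP t r%:R.
  rewrite (le_trans (ler_wpM2l t0 (geom r N.+1 r0)))//.
  by rewrite mulrA ler_pdivrMr//; nra.
rewrite big_ord_recl/= expn0 muln1 (leNgt t) rt/= add0r.
under eq_bigr do rewrite /bump/= add1n expnS mulnA.
by apply: ih; rewrite muln_gt0 r0.
Qed.

End dyadic_sums.

(** * Series of integrals of nonnegative functions *)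

Section nonneg_series.
Context d (T : measurableType d) (R : realType).
Context (m : {measure set T -> \bar R}).
Local Open Scope ereal_scope.

Lemma nneseries_integral_le (a : nat -> T -> R) (b : T -> R) :
  (forall n, measurable_fun [set: T] (a n)) -> measurable_fun [set: T] b ->
  (forall n y, 0 <= a n y)%R ->
  (forall y N, \sum_(n < N) a n y <= b y)%R ->
  \sum_(n <oo) \int[m]_y (a n y)%:E <= \int[m]_y (b y)%:E.
Proof.
move=> ma mb a0 ab.
have b0 y : (0 <= b y)%R by have := ab y 0%N; rewrite big_ord0.
rewrite -integral_nneseries//; last 2 first.
  - by move=> n; exact/measurable_EFinP.
  - by move=> n y _; rewrite lee_fin.
apply: ge0_le_integral => //.
- by move=> y _; apply: nneseries_ge0 => n _ _; rewrite lee_fin.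
- apply: ge0_emeasurable_sum; first by move=> n y _ _; rewrite lee_fin.
  by move=> n _; exact/measurable_EFinP.
- exact/measurable_EFinP.
- move=> y _; apply: lime_le.
    by apply: is_cvg_nneseries => n _ _; rewrite lee_fin.
  by apply: nearW => N; rewrite big_mkord sumEFin lee_fin.
Qed.

(** The sum of the series has finite integral, so it is finite almost everywhere, and the terms of a
    convergent series tend to 0. *)
Lemma ae_cvg0_nneseries_integral (a : nat -> T -> R) :
  (forall n, measurable_fun [set: T] (a n)) -> (forall n y, 0 <= a n y)%R ->
  \sum_(n <oo) \int[m]_y (a n y)%:E < +oo ->
  {ae m, forall y, a n y @[n --> \oo] --> 0%R}.
Proof.
move=> ma a0; rewrite -integral_nneseries//; last 2 first.
  - by move=> n; exact/measurable_EFinP.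
  - by move=> n y _; rewrite lee_fin.
move=> foo.
have int : m.-integrable [set: T] (fun y => \sum_(n <oo) (a n y)%:E).
  apply/integrableP; split.
    apply: ge0_emeasurable_sum; first by move=> n y _ _; rewrite lee_fin.
    by move=> n _; exact/measurable_EFinP.
  under eq_integral => y _.
    rewrite gee0_abs; last by apply: nneseries_ge0 => n _ _; rewrite lee_fin.
    over.
  by [].
have := integrable_ae measurableT int; apply: filterS => y /(_ Logic.I).
rewrite fin_numElt => /andP[_ yoo].
apply: cvg_series_cvg_0; exact: nnseries_is_cvg.
Qed.

End nonneg_series.

(** * The strong law along [r * 2 ^ n], by truncation *)

Section dyadic_slln.
Context d (Omega : measurableType d) d' (T : measurableType d') (R : realType).
Context (P : probability Omega R) (mu : probability T R).
Context (Y : nat -> {RV P >-> T}).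
Hypothesis Yindep : mutually_independent Y.
Hypothesis Ydistr : forall i, has_distribution (Y i) mu.
Context (f : T -> R) (mf : measurable_fun [set: T] f) (f0 : forall y, 0 <= f y).
Hypothesis foo : (\int[mu]_y (f y)%:E < +oo)%E.
Context (r : nat) (r0 : (0 < r)%N).

Local Notation k := (fun n => r * 2 ^ n)%N.

Let kgt0 n : 0 < (k n)%:R :> R.
Proof. by rewrite ltr0n muln_gt0 r0 expn_gt0. Qed.

(* Truncation at a level depending on [n] only, not on the index of the
   summand, keeps the truncated variables identically distributed. *)
Let g n y : R := if f y <= (k n)%:R then f y else 0.

Let g_ge0 n y : 0 <= g n y <= (k n)%:R.
Proof.
rewrite /g; case: ifPn => [->|_]; first by rewrite f0.
by rewrite lexx ltW.
Qed.

Let g_le n y : g n y <= f y.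
Proof. by rewrite /g; case: ifP. Qed.

Let mlvl n : measurable [set y | f y <= (k n)%:R].
Proof. by rewrite -[X in measurable X]setTI; exact: measurable_fun_le. Qed.

Let mg n : measurable_fun [set: T] (g n).
Proof.
rewrite /g; apply: measurable_fun_if => //.
- by apply: measurable_fun_ler.
- exact: measurable_funS mf.
Qed.

Let S N w : R := \sum_(i < N) f (Y i w).
Let Tr n w : R := \sum_(i < k n) g n (Y i w).

Let mTr n : measurable_fun [set: Omega] (Tr n).
Proof. by apply: measurable_sum => i; exact: measurableT_comp. Qed.

Let mean n : R := fine (\int[mu]_y (g n y)%:E).

Let k_le (a b : nat) : (a <= b)%N -> (k a)%:R <= (k b)%:R :> R.
Proof. by move=> ab; rewrite ler_nat leq_mul2l leq_exp2l// ab orbT. Qed.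

Let mean_cvg : mean n @[n --> \oo] --> fine (\int[mu]_y (f y)%:E).
Proof.
have ffin : (\int[mu]_y (f y)%:E)%E \is a fin_num.
  by rewrite ge0_fin_numE// integral_ge0// => y _; rewrite lee_fin.
apply: fine_cvg; rewrite fineK//.
have -> : (\int[mu]_y (f y)%:E = \int[mu]_y limn (fun n => (g n y)%:E))%E.
  apply: eq_integral => y _; apply/esym/cvg_lim => //.
  apply: cvg_near_cst; near=> n.
  rewrite /g ifT//.
  (* Since [n < 2 ^ n <= r * 2 ^ n], the truncation leaves [f y] unchanged as soon as [f y <= n]. *)
  have /le_trans : f y <= n%:R by near: n; exact: nbhs_infty_ger.
  apply; rewrite ler_nat (leq_trans (ltnW (ltn_expl n (ltnSn 1))))//.
  by rewrite leq_pmull.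
apply: cvg_monotone_convergence => //.
- by move=> n; exact/measurable_EFinP.
- by move=> n y _; rewrite lee_fin; case/andP: (g_ge0 n y).
- move=> y _ a b ab; rewrite lee_fin /g.
  case: ifPn => [fa|_]; first by rewrite (le_trans fa (k_le ab)).
  by case: ifP.
Unshelve. all: by end_near. Qed.

Let mean_fin n : (\int[mu]_y (g n y)%:E)%E \is a fin_num.
Proof.
rewrite ge0_fin_numE; last first.
  by apply: integral_ge0 => y _; rewrite lee_fin; case/andP: (g_ge0 n y).
apply: le_lt_trans foo; apply: ge0_le_integral => //.
- by move=> y _; rewrite lee_fin; case/andP: (g_ge0 n y).
- exact/measurable_EFinP.
- exact/measurable_EFinP.
- by move=> y _; rewrite lee_fin.
Qed.

Let expectation_Tr n : fine ('E_P[Tr n])%E = (k n)%:R * mean n.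
Proof.
rewrite unlock /Tr; under eq_integral do rewrite -sumEFin.
rewrite ge0_integral_sum//; last 2 first.
- by move=> i; apply/measurable_EFinP; exact: measurableT_comp.
- by move=> i w _; rewrite lee_fin; case/andP: (g_ge0 n (Y i w)).
under eq_bigr => i _.
  rewrite (ge0_integral_rv Ydistr i (f := EFin \o g n))/=; last 2 first.
  - exact/measurable_EFinP.
  - by move=> y; rewrite lee_fin; case/andP: (g_ge0 n y).
  rewrite -(fineK (mean_fin n)).
  over.
by rewrite sumEFin/= sumr_const card_ord mulr_natl.

Qed.

(** At a fixed [y] only the levels above [f y] contribute, and [sum_dyadic_inv_ge] bounds their
    total by [2 * f y]: the truncated second moments are controlled by the first moment of [f]. *)
Let sum_second_moment :
  (\sum_(n <oo) \int[mu]_y ((k n)%:R^-1 * g n y ^+ 2)%:E < +oo)%E.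
Proof.
apply: (@le_lt_trans _ _ (\int[mu]_y (2 * f y)%:E)%E).
  apply: nneseries_integral_le.
  - by move=> n; apply: measurable_funM => //; exact: measurable_funX.
  - exact: measurable_funM.
  - by move=> n y; rewrite mulr_ge0 ?sqr_ge0// invr_ge0 ltW.
  move=> y N; rewrite [leRHS]mulrC.
  apply: le_trans (ler_wpM2l (f0 y) (sum_dyadic_inv_ge N r0 (f0 y))).
  rewrite mulrA mulr_sumr; apply: ler_sum => n _; rewrite /g.
  by case: ifPn => _; rewrite ?expr0n/= ?mulr0// mulrC expr2.
under eq_integral do rewrite EFinM.
rewrite ge0_integralZl//.
- by rewrite lte_mul_pinfty// lee_fin.
- exact/measurable_EFinP.
- by move=> y _; rewrite lee_fin.
Qed.

(** The squared deviation has integral ['V_P[Tr n]] divided by the square of [k n], which is at most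
    the n-th term of [sum_second_moment]. Summable integrals then force the squares to 0 almost
    surely. *)
Let Tr_cvg : {ae P, forall w,
  (k n)%:R^-1 * Tr n w - mean n @[n --> \oo] --> 0}.
Proof.
pose a n w := ((k n)%:R^-1 * Tr n w - mean n) ^+ 2.
have ma n : measurable_fun [set: Omega] (a n).
  by apply: measurable_funX; apply: measurable_funB => //; exact: measurable_funM.
have a0 n w : 0 <= a n w by exact: sqr_ge0.
have : (\sum_(n <oo) \int[P]_w (a n w)%:E < +oo)%E.
  apply: le_lt_trans sum_second_moment; apply: lee_nneseries => n _.
    by move=> _; apply: integral_ge0 => w _; rewrite lee_fin.
  have -> : (\int[P]_w (a n w)%:E = ((k n)%:R^-1 ^+ 2)%:E * 'V_P[Tr n])%E.
    rewrite /variance unlock unlock -ge0_integralZl//.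
    - apply: eq_integral => w _; rewrite -EFinM; congr EFin.
      have := expectation_Tr n; rewrite unlock /= => E; rewrite /a !fctE/= E.
      have scale (c x m : R) : c != 0 ->
          (c^-1 * x - m) ^+ 2 = c^-1 ^+ 2 * ((x - c * m) * (x - c * m)).
        by move=> c0; field.
      by rewrite -scale// gt_eqF.
    - by apply/measurable_EFinP; apply: measurable_funM;
        apply: measurable_funB.
    - by move=> w _; rewrite lee_fin -[leRHS]expr2 sqr_ge0.
  have Vn := variance_iid_sum_le Yindep Ydistr (k n) (mg n) (g_ge0 n).
  have k2 : (0 <= ((k n)%:R^-1 ^+ 2)%:E :> \bar R)%E by rewrite lee_fin sqr_ge0.
  apply: le_trans (lee_wpmul2l k2 Vn) _.
  rewrite muleA -EFinM -ge0_integralZl//.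
  - apply: ge0_le_integral => //.
    + by move=> y _; rewrite -EFinM lee_fin mulr_ge0 ?sqr_ge0// mulr_ge0 ?sqr_ge0.
    + by apply: measurable_funeM; apply/measurable_EFinP; exact: measurable_funX.
    + apply/measurable_EFinP; apply: measurable_funM => //.
      exact: measurable_funX.
    move=> y _; rewrite -EFinM lee_fin ler_wpM2r ?sqr_ge0//.
    by rewrite expr2 -mulrA mulVf ?mulr1// gt_eqF.
  - by apply/measurable_EFinP; exact: measurable_funX.
  - by move=> y _; rewrite lee_fin sqr_ge0.
move/(ae_cvg0_nneseries_integral ma a0).
apply: filterS => w aw.
apply/cvgr0Pnorm_lt => e e0.
have /(cvgr0Pnorm_lt _).1 /(_ (e ^+ 2) (exprn_gt0 2 e0)) := aw.
apply: filterS => n; rewrite ger0_norm// /a => lt_e.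
by rewrite -(ltr_pXn2r (n := 2))// ?nnegrE ?ltW// real_normK// num_real.
Qed.

(** Borel-Cantelli for the events [F n] that one of the first [k n] values of [f] exceeds the level
    [k n]. The union bound gives [k n * mu (A n)], and [sum_dyadic_lt] bounds the sum over [n] by
    the integral of [2 * f]. *)
Let eventually_untruncated : {ae P, forall w,
  \forall n \near \oo, Tr n w = S (k n) w}.
Proof.
pose A n : set T := [set y | (k n)%:R < f y].
have mA n : measurable (A n).
  rewrite (_ : A n = ~` [set y | f y <= (k n)%:R]); first exact: measurableC.
  by apply/seteqP; split => y; rewrite /A /= ltNge => /negP.
pose F n : set Omega := \big[setU/set0]_(i < k n) (Y i @^-1` A n).
have mYA i n : measurable (Y i @^-1` A n).
  by rewrite -[X in measurable X]setTI; exact: measurable_funP.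
have mF n : measurable (F n) by exact: bigsetU_measurable.
have PF : (\sum_(n <oo) P (F n) < +oo)%E.
  apply: (@le_lt_trans _ _ (\sum_(n <oo) \int[mu]_y ((k n)%:R * \1_(A n) y)%:E)%E).
    apply: lee_nneseries => n _; first by move=> _; exact: measure_ge0.
    apply: (@le_trans _ _ (\sum_(i < k n) P (Y i @^-1` A n))%E).
      exact: (@Boole_inequality _ _ _ P (fun i => Y i @^-1` A n) (k n)).
    under eq_bigr do rewrite (probability_rv Ydistr)//.
    under eq_integral do rewrite EFinM.
    rewrite ge0_integralZl//; last first.
      by apply/measurable_EFinP; exact: measurable_indic.
    rewrite integral_indic// setIT -(fineK (fin_num_measure mu _ (mA n))).
    rewrite [X in (_ <= _ * X)%E](_ : _ = (fine (mu (A n)))%:E); last first.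
      by rewrite fineK// fin_num_measure.
    by rewrite sumEFin sumr_const card_ord -EFinM lee_fin mulr_natl.
  apply: (@le_lt_trans _ _ (\int[mu]_y (2 * f y)%:E)%E).
    apply: nneseries_integral_le.
    - by move=> n; exact: measurable_funM.
    - exact: measurable_funM.
    - by move=> n y; rewrite mulr_ge0.
    move=> y N; apply: le_trans (sum_dyadic_lt r N (f0 y)).
    apply: ler_sum => n _; rewrite indicE.
    have [yA|yA] := boolP (y \in A n).
      by rewrite ifT ?mulr1//; move: yA; rewrite inE.
    by rewrite mulr0; case: ifP.
  under eq_integral do rewrite EFinM.
  rewrite ge0_integralZl//.
  - by rewrite lte_mul_pinfty// lee_fin.
  - exact/measurable_EFinP.
  - by move=> y _; rewrite lee_fin.
have := lim_sup_set_cvg0 mF PF.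
move=> P0; exists (lim_sup_set F); split => //.
  by apply: bigcap_measurable => // n _; exact: bigcup_measurable.
move=> w; apply: contra_notP => wF.
have [n wn] : exists n, forall j, (n <= j)%N -> ~ F j w.
  move: wF; rewrite /lim_sup_set => /existsNP[n /not_implyP[_ wn]].
  by exists n => j nj Fj; apply: wn; exists j.
exists n => // j /= nj; apply: eq_bigr => i _; rewrite /g.
case: ifPn => //; rewrite -ltNge => lt_f; exfalso; apply: (wn j nj).
by rewrite /F -(bigcup_mkord _ (fun i => Y i @^-1` A j)); exists i => //=.
Qed.

Lemma dyadic_slln : {ae P, forall w,
  (k n)%:R^-1 * (\sum_(i < k n) f (Y i w)) @[n --> \oo] -->
    fine (\int[mu]_y (f y)%:E)}.
Proof.
move: Tr_cvg eventually_untruncated; apply: filterS2 => w Tw Sw.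
have cw : ((k n)%:R^-1 * Tr n w - mean n) + mean n @[n --> \oo] -->
  0 + fine (\int[mu]_y (f y)%:E) by apply: cvgD.
rewrite add0r in cw; apply: cvg_trans cw.
by apply: near_eq_cvg; apply: filterS Sw => n /= E; rewrite subrK E.
Qed.

End dyadic_slln.

(* The values of [r * 2 ^ n] with [M <= r <= 2 * M] interpolate the integers
   with ratio at most [1 + M^-1]. *)
Lemma dyadic_interpolation (M N : nat) : (0 < M)%N -> (M <= N)%N ->
  exists r n, [/\ (M <= r < 2 * M)%N, (r * 2 ^ n <= N < r.+1 * 2 ^ n)%N &
    (N < 2 * M * 2 ^ n)%N].
Proof.
move=> M0 MN; pose n := trunc_log 2 (N %/ M).
have NM : (0 < N %/ M)%N by rewrite divn_gt0.
have /andP[n1 n2] : (2 ^ n <= N %/ M < 2 ^ n.+1)%N by exact: trunc_log_bounds.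
have p0 : (0 < 2 ^ n)%N by rewrite expn_gt0.
move: n1 n2; rewrite leq_divRL// ltn_divLR// => n1 n2.
exists (N %/ 2 ^ n)%N, n; split.
- by rewrite leq_divRL// mulnC n1 ltn_divLR// mulnAC -expnS.
- by rewrite leq_trunc_div ltn_ceil.
- by rewrite mulnAC -expnS.
Qed.

(** For [r * 2 ^ n <= N < r.+1 * 2 ^ n], monotonicity encloses [S N] between the values at the two
    ends, whose quotient is at most [1 + M^-1]. Only finitely many [r] occur for a given [M], so the
    assumed limits hold uniformly in them. *)
Lemma mono_mean_cvg (R : realType) (S : nat -> R) (l : R) :
  {homo S : m n / (m <= n)%N >-> m <= n} -> 0 <= S 0%N ->
  (forall r, (0 < r)%N ->
    (r * 2 ^ n)%:R^-1 * S (r * 2 ^ n)%N @[n --> \oo] --> l) ->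
  n%:R^-1 * S n @[n --> \oo] --> l.
Proof.
move=> Smono S0 Scvg.
have Sge0 n : 0 <= S n by rewrite (le_trans S0)// Smono.
have l0 : 0 <= l.
  rewrite -(cvg_lim _ (Scvg 1%N _))//; apply: limr_ge.
    exact: cvgP (Scvg 1%N _).
  by apply: nearW => n; rewrite mulr_ge0// invr_ge0.
apply/cvgrPdist_le => e e0.
have l2 : 0 < l + 2 by rewrite ltr_wpDl.
(* Chosen so that [(l + de) * (1 + de) <= l + de * (l + 2) <= l + e], where [de <= 1] absorbs the
   quadratic term. *)
pose de := Num.min 1 (e / (l + 2)).
have de0 : 0 < de by rewrite lt_min ltr01 divr_gt0.
have de1 : de <= 1 by rewrite ge_min lexx.
have dee : de * (l + 2) <= e by rewrite -ler_pdivlMr// ge_min lexx orbT.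
pose M := (Num.bound de^-1).+1.
have M1 : 1 <= de * M%:R.
  rewrite mulrC -ler_pdivrMr// div1r.
  have /archi_boundP/ltW/le_trans : 0 <= de^-1 by rewrite invr_ge0 ltW.
  by apply; rewrite ler_nat.
(* The range includes [2 * M] because the upper end uses [r.+1] with [r < 2 * M]. *)
have : \forall n \near \oo, forall r : 'I_(2 * M).+1, (0 < r)%N ->
    `|l - (r * 2 ^ n)%:R^-1 * S (r * 2 ^ n)%N| <= de.
  apply: filter_forall => r; have [r0|] := ltnP 0 r; last by move=> _; exact: nearW.
  by have /cvgrPdist_le/(_ _ de0) := Scvg r r0; apply: filterS.
move=> [n0 _ Hn0].
have {}Hn0 n r : (n0 <= n)%N -> (0 < r <= 2 * M)%N ->
    (l - de) * (r * 2 ^ n)%:R <= S (r * 2 ^ n)%N <= (l + de) * (r * 2 ^ n)%:R.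
  move=> n0n /andP[r0 rM].
  have := Hn0 n n0n (Ordinal (rM : (r < (2 * M).+1)%N)) r0 => /=.
  have K0 : 0 < (r * 2 ^ n)%:R :> R by rewrite ltr0n muln_gt0 r0 expn_gt0.
  rewrite mulrC -ler_pdivlMr// -[X in _ && X]ler_pdivrMr// => h.
  by rewrite -!ler_distlC in h *; rewrite h.
exists (2 * M * 2 ^ n0)%N => // N /= MN.
have MN' : (M <= N)%N.
  by rewrite (leq_trans _ MN)// mulnAC leq_pmull// muln_gt0 expn_gt0.
have [r [n [/andP[Mr r2M] /andP[rN Nr] NM]]] := dyadic_interpolation (ltn0Sn _) MN'.
have n0n : (n0 <= n)%N.
  rewrite ltnW//; have := leq_ltn_trans MN NM.
  by rewrite ltn_pmul2l ?muln_gt0// ltn_exp2l.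
have r0 : (0 < r)%N by exact: leq_trans Mr.
have /andP[+ _] := Hn0 n r n0n (introT andP (conj r0 (ltnW r2M))).
have /andP[_ +] := Hn0 n r.+1 n0n r2M.
have := Smono _ _ rN; have := Smono _ _ (ltnW Nr).
have := Sge0 N.
have NR : 0 < N%:R :> R by rewrite ltr0n (leq_trans _ MN').
move: (S N) (S (r * 2 ^ n)%N) (S (r.+1 * 2 ^ n)%N) => s a b s0 sb as_ b_le a_ge.
have NA : (r * 2 ^ n)%:R <= N%:R :> R by rewrite ler_nat.
have NB : N%:R <= (r.+1 * 2 ^ n)%:R :> R by rewrite ler_nat ltnW.
have BA : (r.+1 * 2 ^ n)%:R <= (1 + de) * (r * 2 ^ n)%:R :> R.
  rewrite mulSn natrD mulrDl mul1r addrC lerD2l natrM mulrA ler_peMl//.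
  by rewrite (le_trans M1)//; apply: ler_wpM2l; rewrite ?(ltW de0)// ler_nat.
move: NA NB BA b_le a_ge.
move: (N%:R) NR ((r * 2 ^ n)%:R) ((r.+1 * 2 ^ n)%:R) => q q0 A B NA NB BA b_le a_ge.
rewrite ler_distlC mulrC ler_pdivlMr// ler_pdivrMr//.
have ld0 : 0 <= l + de by rewrite addr_ge0// ltW.
have A0 : 0 <= A by rewrite -(pmulr_rge0 _ (_ : 0 < 1 + de)); lra.
apply/andP; split.
  (* Multiplying the bounds on [N] by [l - e] needs a nonnegative factor; otherwise [0 <= S N]
     suffices. *)
  have [le_e|/ltW le_e] := leP (l - e) 0.
    by rewrite (le_trans _ s0)// mulr_le0_ge0// ltW.
  apply: le_trans as_; apply: le_trans a_ge.
  apply: (le_trans (ler_wpM2l le_e (le_trans NB BA))).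
  by rewrite mulrA ler_wpM2r//; nra.
apply: (le_trans sb); apply: (le_trans b_le).
apply: (le_trans (ler_wpM2l ld0 BA)); rewrite mulrA.
apply: (@le_trans _ _ ((l + de) * (1 + de) * q)).
  by rewrite ler_wpM2l// mulr_ge0//; lra.
by rewrite ler_wpM2r ?(ltW q0)//; nra.
Qed.

(** * The strong law for nonnegative summands *)

Section slln.
Context d (Omega : measurableType d) d' (T : measurableType d') (R : realType).
Context (P : probability Omega R) (mu : probability T R).
Context (Y : nat -> {RV P >-> T}).
Hypothesis Yindep : mutually_independent Y.
Hypothesis Ydistr : forall i, has_distribution (Y i) mu.

Lemma slln_ge0 (f : T -> R) : measurable_fun [set: T] f ->
  (forall y, 0 <= f y) -> (\int[mu]_y (f y)%:E < +oo)%E ->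
  {ae P, forall w, n%:R^-1 * (\sum_(i < n) f (Y i w)) @[n --> \oo] -->
    fine (\int[mu]_y (f y)%:E)}.
Proof.
move=> mf f0 foo.
have : {ae P, forall w r, (r.+1 * 2 ^ n)%:R^-1 *
    (\sum_(i < r.+1 * 2 ^ n) f (Y i w)) @[n --> \oo] -->
    fine (\int[mu]_y (f y)%:E)}.
  by apply: ae_foralln => r; exact: dyadic_slln.
apply: filterS => w Sw.
apply: (@mono_mean_cvg R (fun n => \sum_(i < n) f (Y i w))).
- move=> m n mn /=; rewrite -!(big_mkord xpredT (fun i => f (Y i w))).
  by rewrite (@big_cat_nat _ _ _ m 0 n)//= lerDl sumr_ge0.
- by rewrite big_ord0.
- by case.
Qed.

End slln.

(** * Convergence of approximate minimizers *)

Section kuratowski_argmin.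
Context {R : realType} {X : metricType R}.
Implicit Types (x y z : X) (C : set X).

(** With [H := moment p nu] this is [frechet_set], by [frechet_setE]. *)
Definition near_argmin (H : X -> R) (C : set X) (eta : R) : set X :=
  [set x | C x /\ forall z, C z -> H x <= H z + eta].

Lemma lipschitz1_continuous (N : X -> R) :
  (forall x y, N x <= N y + mdist x y) -> continuous N.
Proof.
move=> lipN x; apply/cvgrPdist_lt => e e0.
have := nbhsx_ballx x e e0; apply: filterS => y; rewrite ballEmdist/= => xy.
rewrite ltr_norml; have := lipN x y; have := lipN y x.
by rewrite (metric_sym y x) => ? ?; apply/andP; split; lra.
Qed.

(** The common Lipschitz constant carries convergence at a nearby point of [D] over to all points
    near [x] at once, so that limits along a countable set determine the joint limit everywhere. *)
Lemma lipschitz1_cvg_joint (N_ : nat -> X -> R) (N : X -> R) (D : set X) :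
  dense D -> (\forall n \near \oo, forall x y, N_ n x <= N_ n y + mdist x y) ->
  (forall x y, N x <= N y + mdist x y) ->
  (forall q, D q -> N_ n q @[n --> \oo] --> N q) ->
  forall x, N_ z.2 z.1 @[z --> (nbhs x, \oo)] --> N x.
Proof.
move=> dD lipN_ lipN cvgD x; apply/cvgrPdist_lt => e e0.
(* One fifth is spent from [x] to [q], one on the convergence at [q], and two on the distance from
   [q] to [z.1] through [x]. *)
have e5 : 0 < e / 5 by rewrite divr_gt0.
have [q [/interior_subset xq Dq]] : (ball x (e / 5))° `&` D !=set0.
  apply: dD; last exact: open_interior.
  by exists x; exact: nbhsx_ballx.
move: xq; rewrite ballEmdist /= => xq.
have /cvgrPdist_lt/(_ _ e5) cq := cvgD q Dq.
exists ([set y | mdist x y < e / 5], [set n | (forall x y,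
    N_ n x <= N_ n y + mdist x y) /\ `|N q - N_ n q| < e / 5]).
  split; last by apply: filterS2 lipN_ cq => n.
  by have := nbhsx_ballx x _ e5; rewrite ballEmdist.
move=> z [/= xz [lz Nq]].
have := lz q z.1; have := lz z.1 q; have := lipN x q; have := lipN q x.
have := metric_triangle q x z.1.
rewrite (metric_sym z.1 q) (metric_sym q x).
move: Nq; rewrite !ltr_norml => /andP[? ?] ? ? ? ? ?.
by apply/andP; split; lra.
Qed.

Lemma Li_near (C_ : nat -> set X) (z : X) (Q : X -> nat -> Prop) :
  Li C_ z -> (\forall y \near z & n \near \oo, Q y n) ->
  \forall n \near \oo, exists2 y, C_ n y & Q y n.
Proof.
move=> Lz [[A B] /= [zA ooB] AB].
have ozA : open_nbhs z A° by split; [exact: open_interior|exact: zA].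
have := Lz _ ozA; apply: filterS2 ooB => n Bn [y [Cy /interior_subset Ay]].
by exists y => //; exact: (AB (y, n)).
Qed.

Lemma not_Ls_near (C_ : nat -> set X) (x : X) : ~ Ls C_ x ->
  \forall y \near x & n \near \oo, ~ C_ n y.
Proof.
move=> /existsNP[U /not_implyP[[oU Ux]]] /contrapT fin.
have [m Hm] : exists m, forall n, (C_ n `&` U !=set0) -> (n < m)%N.
  exists (\max_(i <- fset_set [set n | C_ n `&` U !=set0]) i).+1 => n Cn.
  by rewrite ltnS leq_bigmax_seq// in_fset_set// inE.
exists (U, [set n | (m <= n)%N]).
  by split; [exact: open_nbhs_nbhs|exists m].
move=> [y n] /= [Uy mn] Cy; have := Hm n.
by rewrite ltnNge mn => /(_ (ex_intro _ y (conj Cy Uy))).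
Qed.

Lemma rho_le (A A' : set X) (e : R) :
  (forall x, A x -> exists2 x', A' x' & mdist x x' <= e) ->
  (rho A A' <= e%:E)%E.
Proof.
move=> AA'; apply: ge_ereal_sup => _ [x Ax <-].
have [x' Ax' xx'] := AA' x Ax.
by apply: ge_ereal_inf; exists (mdist x x')%:E; [exists x'|rewrite lee_fin].
Qed.

Lemma rho_ge0 (A A' : set X) : A !=set0 -> (0 <= rho A A')%E.
Proof.
move=> [x Ax]; apply: le_ereal_sup_tmp.
exists (ereal_inf [set (mdist x x')%:E | x' in A']); first by exists x.
by apply: le_ereal_inf_tmp => _ [x' _ <-]; rewrite lee_fin mdist_ge0.
Qed.

Lemma cvg_rho0 (A_ : nat -> set X) (A : set X) :
  (\forall n \near \oo, A_ n !=set0) ->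
  (forall e, 0 < e -> \forall n \near \oo, forall x, A_ n x ->
    exists2 x', A x' & mdist x x' <= e) ->
  rho (A_ n) A @[n --> \oo] --> 0%E.
Proof.
move=> A0 AA; have rho_near e : 0 < e ->
    \forall n \near \oo, (0 <= rho (A_ n) A <= e%:E)%E.
  move=> /AA; apply: filterS2 A0 => n n0 nA.
  by rewrite rho_ge0// rho_le.
apply: cvg_EFin.
  apply: filterS (rho_near 1 ltr01) => n /andP[r0 r1].
  by rewrite ge0_fin_numE// (le_lt_trans r1) ?ltry.
apply/cvgr0Pnorm_le => e e0; apply: filterS (rho_near e e0) => n /andP[r0 re].
have rfin : rho (A_ n) A \is a fin_num.
  by rewrite ge0_fin_numE// (le_lt_trans re) ?ltry.
by rewrite /= ger0_norm ?fine_ge0// -lee_fin fineK.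
Qed.

Definition closed_mball (o : X) (r : R) : set X := [set x | mdist o x <= r].

Lemma closed_mball_closed (o : X) (r : R) : closed (closed_mball o r).
Proof.
have cd : continuous (mdist o).
  apply: lipschitz1_continuous => x y.
  by rewrite (metric_sym x) metric_triangle.
by apply: (@closed_comp _ _ (mdist o) [set t | t <= r]) => // x _; exact: cd.
Qed.

Lemma heine_borel_compact_mball (o : X) (r : R) : heine_borel X ->
  compact (closed_mball o r).
Proof.
move=> hX; apply: hX; first exact: closed_mball_closed.
exists (r + r) => x y; rewrite /closed_mball/= => ox oy.
by rewrite (le_trans (metric_triangle _ o _))// (metric_sym x) lerD.
Qed.

(** Coercivity confines the approximate minimizers to one compact ball [K], and the extreme value
    theorem on [K] makes them exist. Near each point of [K] the claim holds for large [n];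
    compactness makes that threshold uniform over [K]. *)
Lemma near_argmin_rho_cvg (o : X) (H_ : nat -> X -> R) (H : X -> R)
    (C_ : nat -> set X) (C : set X) (eta_ : nat -> R) (eta : R) :
  heine_borel X ->
  (forall x, H_ z.2 z.1 @[z --> (nbhs x, \oo)] --> H x) ->
  (forall M, exists r, \forall n \near \oo,
    [set x | H_ n x <= M] `<=` closed_mball o r) ->
  (\forall n \near \oo, continuous (H_ n)) ->
  (forall n, closed (C_ n)) -> C !=set0 -> Lt C_ C ->
  (forall n, 0 <= eta_ n) -> eta_ n @[n --> \oo] --> eta ->
  rho (near_argmin (H_ n) (C_ n) (eta_ n)) (near_argmin H C eta)
    @[n --> \oo] --> 0%E.
Proof.
move=> hX Hjoint Hcoer Hcont C_closed [z0 Cz0] [LsC LiC] eta_ge0 eta_cvg.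
have Hlt z (e : R) : 0 < e -> \forall y \near z & n \near \oo, `|H z - H_ n y| < e.
  by move=> e0; have /cvgrPdist_lt/(_ _ e0) := Hjoint z.
have etalt (e : R) : 0 < e -> \forall n \near \oo, `|eta - eta_ n| < e.
  by move=> e0; have /cvgrPdist_lt/(_ _ e0) := eta_cvg.
have Hz z (e : R) : 0 < e -> C z ->
    \forall n \near \oo, exists2 y, C_ n y & H_ n y < H z + e.
  move=> e0; rewrite -LiC => Lz; have := Li_near Lz (Hlt z e e0).
  apply: filterS => n [y Cy]; rewrite ltr_norml => /andP[h _].
  by exists y => //; lra.
(* Points of [C_ n] near [z0] have value below [H z0 + 1], and [eta_ n < eta + 1]; an approximate
   minimizer thus stays below the sum of the two. *)
have [r Kr] := Hcoer (H z0 + eta + 2).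
pose K := closed_mball o r.
have cK : compact K by exact: heine_borel_compact_mball.
have FK : \forall n \near \oo, near_argmin (H_ n) (C_ n) (eta_ n) `<=` K.
  apply: filterS3 Kr (Hz z0 1 ltr01 Cz0) (etalt 1 ltr01) => n nK [y Cy Hy].
  rewrite ltr_norml => /andP[h _] x [Cx /(_ y Cy) Hx].
  by apply: nK => /=; lra.
apply: cvg_rho0.
  near=> n.
  have [y Cy Hy] : exists2 y, C_ n y & H_ n y < H z0 + 1.
    by near: n; exact: Hz.
  have eta0 : `|eta - eta_ n| < 1 by near: n; exact: etalt.
  have nK : [set x | H_ n x <= H z0 + eta + 2] `<=` K by near: n.
  have cH : continuous (H_ n) by near: n.
  have Ky : K y.
    apply: nK => /=; have := eta_ge0 n.
    by move: eta0; rewrite ltr_norml => /andP[? ?] ?; lra.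
  have [c] : exists2 c, c \in (C_ n `&` K) &
      forall t, t \in (C_ n `&` K) -> H_ n c <= H_ n t.
    apply: compact_EVT_min; first by exists y.
      by rewrite setIC; exact: compact_closedI.
    exact: continuous_subspaceT.
  rewrite inE => -[Cc Kc] minc; exists c; split => // t Ct.
  (* A minimizer over [C_ n] within [K] is a minimizer over all of [C_ n]: outside [K] the values
     exceed [H z0 + eta + 2], hence that of [y]. *)
  have [Kt|nKt] := pselect (K t).
    by rewrite ler_wpDr// minc// inE.
  have : H z0 + eta + 2 < H_ n t.
    by rewrite ltNge; apply/negP => Ht; apply: nKt; exact: nK.
  have := minc y; rewrite inE => /(_ (conj Cy Ky)).
  have := eta_ge0 n; move: eta0; rewrite ltr_norml => /andP[? ?] ? ? ?.
  lra.
move=> e e0.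
suff : \forall n \near \oo, K `<=` [set x | near_argmin (H_ n) (C_ n) (eta_ n) x ->
    exists2 x', near_argmin H C eta x' & mdist x x' <= e].
  apply: filterS2 FK => n FnK Kn x Fx; exact: Kn (FnK x Fx) Fx.
have /compact_near_coveringP := cK; apply => x Kx.
(* Three cases: [x] is itself a limit minimizer close to its neighbours; [x] is outside [C], and
   nearby points eventually leave [C_ n]; or some [z] in [C] beats [x] by more than [eta]. *)
have [Fx|nFx] := pselect (near_argmin H C eta x).
  exists (ball x e, setT) => /=.
    by split; [exact: nbhsx_ballx|exact: filterT].
  move=> [y n] /= [+ _] _; rewrite ballEmdist/= => /ltW xy.
  by exists x => //; rewrite metric_sym.
have [Cx|nCx] := pselect (C x); last first.
  have : ~ Ls C_ x by rewrite LsC.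
  move=> /not_Ls_near [[A B] AB AB']; exists (A, B) => // -[y n] /AB' /= nCy.
  by move=> [].
have [z Cz Hxz] : exists2 z, C z & H z + eta < H x.
  move/not_andP : nFx => [//|/existsNP[z /not_implyP[Cz /negP]]].
  by rewrite -ltNge; exists z.
(* A third of the gap for each of three errors: [H_ n] near [x], [H_ n] near [z], and [eta_ n]. *)
pose g := (H x - (H z + eta)) / 3.
have g0 : 0 < g by rewrite divr_gt0// subr_gt0.
have [[A B] /= [xA ooB] AB] := Hlt x g g0.
exists (A, [set n | [/\ B n, `|eta - eta_ n| < g &
  exists2 y, C_ n y & H_ n y < H z + g]]).
  split => //; near=> n; split; near: n => //; [exact: etalt|exact: Hz].
move=> [y n] /= [Ay [Bn eta_lt [t Ct Ht]]] [_ /(_ t Ct) Fy].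
have := AB (y, n) (conj Ay Bn) => /=.
move: eta_lt Ht; rewrite !ltr_norml /g => /andP[h1 h2] Ht /andP[h3 h4].
by exfalso; clear -Fy h1 h2 h3 h4 Ht; lra.
Unshelve. all: by end_near. Qed.

End kuratowski_argmin.

(** * Separability of Heine-Borel spaces *)

Section separability.
Context {R : realType} {X : pmetricType R}.

(** Each closed ball of integer radius about [point] is compact, so finitely many balls of radius
    [m.+1%:R^-1] cover it; the centres over all radii form a countable dense set. *)
Lemma heine_borel_separable : heine_borel X ->
  exists q : nat -> X, dense (range q).
Proof.
move=> hX.
have cov (nm : nat * nat) : exists D : {fset X},
    closed_mball point nm.1%:R `<=`
    \bigcup_(i in [set` D]) (ball i (nm.2.+1%:R^-1 : R))°.
  have := @heine_borel_compact_mball R X point nm.1%:R hX.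
  rewrite compact_cover => /(_ X setT (fun i => (ball i (nm.2.+1%:R^-1 : R))°)).
  case.
  - by move=> i _; exact: open_interior.
  - by move=> x _; exists x => //; exact: nbhsx_ballx.
  - by move=> D _ DK; exists D.
have [D HD] := choice cov.
pose Q : set X := \bigcup_nm [set` D nm].
have cQ : countable Q.
  exact: bigcup_countable.
have dQ : dense Q.
  move=> O [x Ox] oO; have /nbhs_ballP[e /= e0 xeO] := open_nbhs_nbhs (conj oO Ox).
  pose n := Num.bound (mdist point x); pose m := Num.bound e^-1.
  have xn : closed_mball point n%:R x.
    by rewrite /closed_mball /= ltW// archi_boundP// mdist_ge0.
  have [q Dq /interior_subset qx] := HD (n, m) x xn.
  exists q; split; last by exists (n, m).
  apply: xeO; apply/ball_sym/(le_ball _ qx) => /=.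
  rewrite -[leRHS]invrK lef_pV2 ?posrE ?invr_gt0//.
  have /archi_boundP/ltW/le_trans : 0 <= e^-1 by rewrite invr_ge0 ltW.
  by apply; rewrite ler_nat.
move/pfcard_geP: cQ => [Q0|[q]].
  have [y []] := dQ setT (ex_intro _ point Logic.I) openT.
  by rewrite Q0.
exists q => O O0 oO; have [y [Oy Qy]] := dQ O O0 oO.
exists y; split => //; have [n _ <-] := surj (f := q) Qy.
by exists n.
Qed.

End separability.

(** * Moments as functions of the base point *)

Section powR_limits.
Context {R : realType}.

Lemma cvg_powR {T : Type} (F : set_system T) {FF : Filter F} (f : T -> R)
    (a p : R) : 0 < p -> 0 <= a -> (forall t, 0 <= f t) ->
  f @ F --> a -> f t `^ p @[t --> F] --> a `^ p.
Proof.
move=> p0 a0 f0 fa; apply/cvgrPdist_lt => e e0.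
have ip0 : 0 < p^-1 by rewrite invr_gt0.
have powK t : 0 <= t -> (t `^ p) `^ p^-1 = t.
  by move=> t0; rewrite -powRrM divff ?gt_eqF// powRr1.
have powK' t : 0 <= t -> (t `^ p^-1) `^ p = t.
  by move=> t0; rewrite -powRrM mulVf ?gt_eqF// powRr1.
have up : \forall t \near F, f t `^ p < a `^ p + e.
  have : a < (a `^ p + e) `^ p^-1.
    by rewrite -{1}(powK a)// gt0_ltr_powR ?nnegrE ?addr_ge0 ?powR_ge0 ?ltrDl// ltW.
  move=> /(cvgr_lt _ fa); apply: filterS => t ft.
  rewrite -[ltRHS]powK' ?addr_ge0 ?powR_ge0 ?(ltW e0)//.
  by rewrite gt0_ltr_powR ?nnegrE ?powR_ge0.
have lo : \forall t \near F, a `^ p - e < f t `^ p.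
  have [ae|ae] := ltP (a `^ p - e) 0.
    by apply: nearW => t; rewrite (lt_le_trans ae)// powR_ge0.
  have : (a `^ p - e) `^ p^-1 < a.
    by rewrite -{2}(powK a)// gt0_ltr_powR ?nnegrE ?powR_ge0// gtrBl.
  move=> /(cvgr_gt _ fa); apply: filterS => t ft.
  rewrite -[ltLHS]powK'//.
  by rewrite gt0_ltr_powR ?nnegrE ?powR_ge0.
by apply: filterS2 up lo => t up lo; rewrite ltr_distlC lo.
Qed.

End powR_limits.

Section moments.
Context {R : realType} {X : pmetricType R}.
Implicit Types (nu : {measure set (borel X) -> \bar R}) (p : R).

Lemma continuous_measurable_borel (f : X -> R) : continuous f ->
  measurable_fun [set: borel X] (f : borel X -> R).
Proof.
move=> cf; apply: (measurability _ (RGenOInfty.measurableE R)) => _ [_ [a ->] <-].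
rewrite setTI; apply: sub_sigma_algebra.
by apply: (open_comp (f := f) (D := `]a, +oo[%classic)) => // x _; exact: cf.
Qed.

Lemma measurable_mdist (x : X) :
  measurable_fun [set: borel X] (mdist x : borel X -> R).
Proof.
apply: continuous_measurable_borel; apply: lipschitz1_continuous => y z.
by rewrite (metric_sym y) metric_triangle.
Qed.

Lemma measurable_mdist_powR (x : X) p :
  measurable_fun [set: borel X] (fun y : borel X => mdist x y `^ p).
Proof.
apply: (@measurableT_comp _ _ _ _ _ _ (@powR R ^~ p)) => //.
exact: measurable_mdist.
Qed.

(** [fine] sends an infinite integral to 0; [momentE] identifies the value with the integral under
    [finite_moment]. *)
Definition moment p nu (x : X) : R :=
  fine (\int[nu]_(y in [set: borel X]) (mdist x y `^ p)%:E)%E.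

Lemma momentE p nu x : finite_moment p nu ->
  (\int[nu]_(y in [set: borel X]) (mdist x y `^ p)%:E = (moment p nu x)%:E)%E.
Proof.
move=> fm; rewrite /moment fineK// ge0_fin_numE; first exact: fm.
by apply: integral_ge0 => y _; rewrite lee_fin powR_ge0.
Qed.

Lemma moment_ge0 p nu x : 0 <= moment p nu x.
Proof.
by apply/fine_ge0/integral_ge0 => y _; rewrite lee_fin powR_ge0.
Qed.

(** The finite p-th moment makes both powers integrable, so the integral of the difference
    splits. *)
Lemma frechet_diffE p nu x z : finite_moment p nu ->
  frechet_diff p nu x z = (moment p nu x - moment p nu z)%:E.
Proof.
move=> fm.
have int u : nu.-integrable [set: borel X] (EFin \o (fun y => mdist u y `^ p)).
  apply/integrableP; split.
    by apply/measurable_EFinP; exact: measurable_mdist_powR.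
  under eq_integral do rewrite /= ger0_norm ?powR_ge0//.
  exact: fm.
rewrite /frechet_diff integralB_EFin//.
by rewrite -/(moment p nu x) !momentE.
Qed.

Lemma frechet_setE p nu (C : set X) (eta : R) : finite_moment p nu ->
  frechet_set p nu C eta = near_argmin (moment p nu) C eta.
Proof.
move=> fm; apply/seteqP; split => x [Cx Hx]; split => // z Cz.
  by have := Hx z Cz; rewrite frechet_diffE// lee_fin lerBlDl.
by rewrite frechet_diffE// lee_fin lerBlDl Hx.
Qed.

(** The [L^p] norm of [mdist x] under [nu], by [Lnorm_mdist]. *)
Definition mean_dist p nu (x : X) : R := moment p nu x `^ p^-1.

Lemma Lnorm_mdist p nu x : finite_moment p nu ->
  ('N[nu]_p%:E [EFin \o (mdist x : borel X -> R)] = (mean_dist p nu x)%:E)%E.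
Proof.
move=> fm; rewrite unlock.
rewrite (@eq_integral _ _ _ nu _ (fun y => (mdist x y `^ p)%:E)).
  by rewrite (momentE x fm).
by move=> y _; rewrite /= ger0_norm ?mdist_ge0.
Qed.

Lemma Lnorm_cst_prob p nu (c : R) : nu [set: borel X] = 1%E -> p != 0 -> 0 <= c ->
  ('N[nu]_p%:E [EFin \o (cst c : borel X -> R)] = c%:E)%E.
Proof.
move=> nu1 p0 c0; rewrite unlock.
under eq_integral do rewrite /= ger0_norm//.
rewrite integral_cst// nu1 mule1 poweR_EFin -powRrM divff// powRr1//.
Qed.

Lemma Lnorm_triangle_le p nu (f g h : borel X -> R) : 1 <= p ->
  measurable_fun [set: borel X] f -> measurable_fun [set: borel X] g ->
  measurable_fun [set: borel X] h ->
  (forall y, 0 <= f y) -> (forall y, f y <= g y + h y) ->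
  ('N[nu]_p%:E [EFin \o f] <= 'N[nu]_p%:E [EFin \o g] + 'N[nu]_p%:E [EFin \o h])%E.
Proof.
move=> p1 mf mg mh f0 fgh.
apply: le_trans (minkowski_EFin nu mg mh p1).
have p0 : 0 < p by exact: lt_le_trans p1.
have mpow (k : borel X -> R) : measurable_fun [set: borel X] k ->
    measurable_fun [set: borel X] (fun y => (`|k y| `^ p)%:E).
  move=> mk; apply/measurable_EFinP.
  apply: (@measurableT_comp _ _ _ _ _ _ (@powR R ^~ p)) => //.
  exact: measurableT_comp.
rewrite unlock gt0_ler_poweR ?invr_ge0 ?(ltW p0)//.
- by rewrite in_itv/= leey andbT integral_ge0.
- by rewrite in_itv/= leey andbT integral_ge0.
apply: ge0_le_integral => //.
- by move=> y _; exact: poweR_ge0.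
- exact: (mpow f mf).
- exact: (mpow (g \+ h) (measurable_funD mg mh)).
- move=> y _ /=; rewrite lee_fin ge0_ler_powR ?nnegrE ?(ltW p0)//.
  by rewrite ger0_norm// (le_trans (fgh y))// ler_norm.
Qed.

(** * Lipschitz and coercivity bounds for the p-th root of the moment *)

Section mean_dist_prob.
Context (p : R) (p1 : 1 <= p).
Context (nu : {measure set (borel X) -> \bar R}).
Context (nu1 : nu [set: borel X] = 1%E) (fm : finite_moment p nu).

Let p0 : 0 < p. Proof. exact: lt_le_trans p1. Qed.

(** Minkowski's inequality for [mdist x y <= mdist z y + mdist x z]; under a probability the
    constant is its own norm, so the Lipschitz constant is 1 for every such [nu]. *)
Lemma mean_dist_lipschitz x z :
  mean_dist p nu x <= mean_dist p nu z + mdist x z.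
Proof.
have := @Lnorm_triangle_le p nu (mdist x) (mdist z) (cst (mdist x z)) p1
  (measurable_mdist x) (measurable_mdist z) (measurable_cst _).
rewrite (Lnorm_mdist x fm) (Lnorm_mdist z fm).
rewrite (Lnorm_cst_prob nu1 (lt0r_neq0 p0) (mdist_ge0 x z)) lee_fin; apply.
- by move=> y; exact: mdist_ge0.
- by move=> y /=; rewrite addrC metric_triangle.
Qed.

(** Minkowski's inequality with the constant [mdist o x] on the left. It is the source of
    coercivity: a bound on the moment at [x] bounds the distance from [o]. *)
Lemma mdist_le_mean_dist o x :
  mdist o x <= mean_dist p nu o + mean_dist p nu x.
Proof.
have := @Lnorm_triangle_le p nu (cst (mdist o x)) (mdist o) (mdist x) p1
  (measurable_cst _) (measurable_mdist o) (measurable_mdist x).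
rewrite (Lnorm_mdist x fm) (Lnorm_mdist o fm).
rewrite (Lnorm_cst_prob nu1 (lt0r_neq0 p0) (mdist_ge0 o x)) lee_fin; apply.
- by move=> y; exact: mdist_ge0.
- by move=> y /=; rewrite (metric_sym x) metric_triangle.
Qed.

Lemma moment_mean_dist x : moment p nu x = mean_dist p nu x `^ p.
Proof.
by rewrite /mean_dist -powRrM mulVf ?gt_eqF// powRr1// moment_ge0.
Qed.

Lemma mean_dist_continuous : continuous (mean_dist p nu).
Proof. by apply: lipschitz1_continuous => x y; exact: mean_dist_lipschitz. Qed.

Lemma moment_continuous : continuous (moment p nu).
Proof.
rewrite (funext moment_mean_dist) => x.
apply: cvg_powR => //; [exact: powR_ge0|by move=> y; exact: powR_ge0|].
exact: mean_dist_continuous.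
Qed.

End mean_dist_prob.

(** * Moments of empirical measures *)

Section empirical.
Context (y : nat -> borel X).

Lemma ge0_integral_empirical (n : nat) (f : borel X -> R) :
  measurable_fun [set: borel X] f -> (forall x, 0 <= f x) ->
  (\int[empirical_measure y n]_(x in [set: borel X]) (f x)%:E =
   (n%:R^-1 * \sum_(i < n) f (y i))%:E)%E.
Proof.
move=> mf f0; have mf' : measurable_fun [set: borel X] (EFin \o f).
  exact/measurable_EFinP.
rewrite ge0_integral_mscale// ?ge0_integral_measure_sum//.
- under eq_bigr do rewrite integral_dirac// diracT mul1e.
  by rewrite sumEFin -EFinM.
- by move=> x _; rewrite lee_fin.
- by move=> x _; rewrite lee_fin.
Qed.

Lemma empirical_measure_setT (n : nat) : (0 < n)%N ->
  empirical_measure y n [set: borel X] = 1%E.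
Proof.
move=> n0; rewrite -[LHS]mul1e -integral_cst//.
apply: etrans (@ge0_integral_empirical n (cst 1) (measurable_cst _) _) _.
  by move=> x; exact: ler01.
by rewrite sumr_const card_ord mulVf// pnatr_eq0 -lt0n.
Qed.

Lemma empirical_finite_moment p (n : nat) :
  finite_moment p (empirical_measure y n).
Proof.
move=> x; rewrite ge0_integral_empirical ?ltry//.
- exact: measurable_mdist_powR.
- by move=> z; exact: powR_ge0.
Qed.

Lemma empirical_moment p (n : nat) x :
  moment p (empirical_measure y n) x =
  n%:R^-1 * \sum_(i < n) mdist x (y i) `^ p.
Proof.
rewrite /moment (@ge0_integral_empirical n (fun z => mdist x z `^ p))//.
- exact: measurable_mdist_powR.
- by move=> z; exact: powR_ge0.
Qed.

End empirical.

End moments.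

(** * Almost sure convergence of the Fréchet mean sets *)

Theorem theorem4p4 (R : realType) (X : pmetricType R) (p : R)
    (hp : 1 <= p) (hX : heine_borel X)
    (mu : probability (borel X) R) (hmu : finite_moment p mu)
    (d : measure_display) (Omega : measurableType d) (P : probability Omega R)
    (hP : measure_is_complete P)
    (Y : nat -> {RV P >-> borel X})
    (hYindep : mutually_independent Y)
    (hYdistr : forall i, has_distribution (Y i) mu)
    (C_ : nat -> Omega -> closedSet X) (eta_ : nat -> Omega -> R)
    (C : Omega -> closedSet X) (eta : Omega -> R)
    (heta_ : forall n w, 0 <= eta_ n w) (heta : forall w, 0 <= eta w)
    (hCeta_ : forall n, measurable_fun [set: Omega]
       (fun w => (C_ n w, eta_ n w) : (effros X * R)%type))
    (hCeta : measurable_fun [set: Omega]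
       (fun w => (C w, eta w) : (effros X * R)%type)) :
  {ae P, forall w,
    C w !=set0 ->
    Lt (fun n => C_ n w) (C w) ->
    eta_ n w @[n --> \oo] --> eta w ->
    rho (frechet_set p (empirical_measure (fun i => Y i w) n)
           (C_ n w) (eta_ n w))
        (frechet_set p mu (C w) (eta w)) @[n --> \oo] --> 0%E}.
Proof.
have p0 : 0 < p by exact: lt_le_trans hp.
have [q dq] := heine_borel_separable hX.
have slln j := slln_ge0 hYindep hYdistr (measurable_mdist_powR (q j) p)
  (fun y => powR_ge0 _ _) (hmu (q j)).
(* One null set serves all the [q j]; from here on [w] is fixed and the argument is
   deterministic. *)
have := ae_foralln slln; apply: filterS => w Sw C0 LtC eta_cvg.
pose emp := empirical_measure (fun i => Y i w).
have emp1 n : (0 < n)%N -> emp n [set: borel X] = 1%E.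
  exact: empirical_measure_setT.
have empf n : finite_moment p (emp n) by exact: empirical_finite_moment.
have mu1 : mu [set: borel X] = 1%E by exact: probability_setT.
have -> : (fun n => rho (frechet_set p (emp n) (C_ n w) (eta_ n w))
      (frechet_set p mu (C w) (eta w))) =
    (fun n => rho (near_argmin (moment p (emp n)) (C_ n w) (eta_ n w))
      (near_argmin (moment p mu) (C w) (eta w))).
  by apply/funext => n; rewrite !frechet_setE.
have mean_cvg j : mean_dist p (emp n) (q j) @[n --> \oo] --> mean_dist p mu (q j).
  apply: cvg_powR; rewrite ?invr_gt0 ?moment_ge0//.
  - by move=> n; exact: moment_ge0.
  - apply: cvg_trans (Sw j); apply: near_eq_cvg; apply: nearW => n.
    by rewrite empirical_moment.
apply: (@near_argmin_rho_cvg _ _ (q 0%N)) => //.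
- move=> x; rewrite (moment_mean_dist hp).
  have -> : (fun z : X * nat => moment p (emp z.2) z.1) =
      (fun z => mean_dist p (emp z.2) z.1 `^ p).
    by apply/funext => z; exact: moment_mean_dist.
  apply: cvg_powR => //; [exact: powR_ge0|by move=> z; exact: powR_ge0|].
  apply: (@lipschitz1_cvg_joint _ _ (fun n => mean_dist p (emp n)) (mean_dist p mu)
    _ dq).
  (* The Lipschitz bound needs a probability, and [emp n] is one from [n = 1] on. *)
  + exists 1%N => // n /= n1 x' y'.
    exact: mean_dist_lipschitz (emp1 n n1) (empf n) x' y'.
  + by move=> x' y'; exact: mean_dist_lipschitz.
  + by move=> _ [j _ <-]; exact: mean_cvg.
(* The first two terms eventually bound [mean_dist p (emp n)] at [q 0], the last one bounds it at
   any [x] of moment at most [M]; their sum bounds the distance by [mdist_le_mean_dist]. *)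
- move=> M; exists (mean_dist p mu (q 0%N) + 1 + `|M| `^ p^-1).
  have /cvgrPdist_lt/(_ _ ltr01) := mean_cvg 0%N.
  apply: filterS2 (nbhs_infty_gt 0) => n n0.
  rewrite ltr_distlC => /andP[_ lt_mean] x /= Hx.
  have := mdist_le_mean_dist hp (emp1 n n0) (empf n) (q 0%N) x.
  move=> /le_trans; apply; apply: lerD; first exact: ltW.
  rewrite /mean_dist ge0_ler_powR ?nnegrE ?moment_ge0 ?invr_ge0 ?(ltW p0)//.
  exact: le_trans Hx (ler_norm M).
- exists 1%N => // n /= n1; exact: moment_continuous (emp1 n n1) (empf n).
- by move=> n; exact: closedSet_closed.
Qed.
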